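(* Let $b\in\mathbb{R}$, $b\neq 0$, and let $m$ be a real-valued random variable with an arbitrary probability measure. Consider the scalar quadratic cheap talk game with encoder cost $c^e(m,u)=(m-u-b)^2$ and decoder cost $c^d(m,u)=(m-u)^2$, where the strategy set of the encoder consists of all measurable (deterministic) functions from $\mathbb{M}=\mathbb{R}$ to $\mathbb{X}$. Then any Nash equilibrium encoder policy is quantized almost surely, in the sense that it is equivalent to a quantized encoder policy: the performance (expected costs) of any equilibrium encoder policy is equal to the performance of a quantized encoder policy. Furthermore, the quantization bins are convex (i.e., intervals).
   Context: Cheap talk game: the encoder observes $m$ and sends $x=\gamma^e(m)\in\mathbb{X}$; the decoder receives $x$ (no noise) and chooses the action $u=\gamma^d(x)\in\mathbb{R}$, where $\gamma^d$ is measurable. The encoder aims to minimize $J^e(\gamma^e,\gamma^d)=\mathbb{E}[(m-u-b)^2]$ and the decoder aims to minimize $J^d(\gamma^e,\gamma^d)=\mathbb{E}[(m-u)^2]$. The constant $b$ is called the bias. A pair $(\gamma^{*,e},\gamma^{*,d})$ is a Nash equilibrium if $J^e(\gamma^{*,e},\gamma^{*,d})\le J^e(\gamma^e,\gamma^{*,d})$ for all encoder policies $\gamma^e$ and $J^d(\gamma^{*,e},\gamma^{*,d})\le J^d(\gamma^{*,e},\gamma^d)$ for all decoder policies $\gamma^d$. An encoder policy is quantized if it takes at most countably many values; its bins are the sets of source values $m$ mapped to the same message. The performance of an encoder policy in an equilibrium is measured by the pair of expected costs $(J^e,J^d)$. *)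

(* Defs.v *)
From HB Require Import structures.
From mathcomp Require Import all_boot all_order all_algebra.
From mathcomp Require Import all_classical all_reals all_analysis.
Import Order.TTheory GRing.Theory Num.Theory.
Import numFieldNormedType.Exports.
Set Implicit Arguments.
Unset Strict Implicit.
Unset Printing Implicit Defensive.
Local Open Scope classical_set_scope.
Local Open Scope ring_scope.

Section CheapTalk.
Context {R : realType} {dO dX : measure_display}.
Context {Omega : measurableType dO} {X : measurableType dX}.

(* Message space: an arbitrary measurable space X. *)
Definition encoder_policy := {mfun R >-> X}.
Definition decoder_policy := {mfun X >-> R}.

Definition encoder_cost (b m u : R) : R := (m - u - b) ^+ 2.
Definition decoder_cost (m u : R) : R := (m - u) ^+ 2.

(* The costs are nonnegative, so these expectations always make sense in
   [\bar R]; they may be infinite, since m need not have a second moment. *)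
Definition Je (P : probability Omega R) (m : {RV P >-> R}) (b : R)
    (ge : encoder_policy) (gd : decoder_policy) : \bar R :=
  'E_P[fun w => encoder_cost b (m w) (gd (ge (m w)))].

Definition Jd (P : probability Omega R) (m : {RV P >-> R})
    (ge : encoder_policy) (gd : decoder_policy) : \bar R :=
  'E_P[fun w => decoder_cost (m w) (gd (ge (m w)))].

Definition nash_equilibrium (P : probability Omega R) (m : {RV P >-> R})
    (b : R) (ge : encoder_policy) (gd : decoder_policy) : Prop :=
  (forall ge' : encoder_policy, (Je m b ge gd <= Je m b ge' gd)%E) /\
  (forall gd' : decoder_policy, (Jd m ge gd <= Jd m ge gd')%E).

Definition quantized (ge : encoder_policy) : Prop := countable (range ge).

Definition bin (ge : encoder_policy) (x : X) : set R := ge @^-1` [set x].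

(* [bin ge x] is empty, hence trivially an interval, for an unused message. *)
Definition convex_bins (ge : encoder_policy) : Prop :=
  forall x, is_interval (bin ge x).

End CheapTalk.

Arguments encoder_policy R {dX} X.
Arguments decoder_policy R {dX} X.

(* Main.v *)
Require Import Defs.
From HB Require Import structures.
From mathcomp Require Import all_boot all_order all_algebra.
From mathcomp Require Import all_classical all_reals all_analysis.
From mathcomp Require Import measurable_realfun lra ring.
Import Order.TTheory GRing.Theory Num.Theory.
Import numFieldNormedType.Exports.
Local Open Scope classical_set_scope.
Local Open Scope ring_scope.

(* Write u(m) for the action induced by an equilibrium. If Je is finite, u(m) is
   almost surely an available action nearest to m - b. If p is an available
   action and u lies strictly between p and p + 2b, then preferring u to p
   places m beyond u + h, in the direction of b, with h = b - (u - p)/2; so the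
   decoder would gain by replying u + h. Hence almost surely u avoids all these
   gaps. The available actions outside the gaps are 2|b| apart, hence countably
   many, and u selects a nearest one. Any selection of nearest points is
   monotone, so u agrees almost surely with a monotone map with countably many
   values.

   If Je is infinite, so is Jd, and comparing the decoder with constant
   ones shows that m has infinite second moment; a constant encoder works. *)

(** * Inequalities between squared distances *)

Lemma sqr_leB (R : realFieldType) (t p q : R) :
  ((t - p) ^+ 2 <= (t - q) ^+ 2) = (0 <= (p - q) * (t *+ 2 - p - q)).
Proof. rewrite -subr_ge0; congr (0 <= _); ring. Qed.

(** The new reply [u + h], with [h = b - (u - p) / 2], equals [(u + p) / 2 + b], the source value at
    which the encoder is indifferent between [u] and [p]. Preferring [u] puts [c = t - (u + h)] on
    the side of [u - p], hence of [b]; the upper bound on the gap gives [h] that sign too. So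
    [(t - u)^2 = (c + h)^2 >= c^2 + h^2 > c^2]. *)
Lemma gap_gain (R : realFieldType) (b t p u : R) :
  0 < (u - p) * b < b ^+ 2 *+ 2 ->
  (t - u - b) ^+ 2 <= (t - p - b) ^+ 2 ->
  (t - (u + (b - (u - p) / 2))) ^+ 2 < (t - u) ^+ 2.
Proof.
move=> /andP[up0 up2] opt.
have h0 : 0 < b * (b - (u - p) / 2) by lra.
have hb : 0 <= b * (t - u - (b - (u - p) / 2)).
  have b0 : b != 0 by apply/eqP => b0; move: h0; rewrite b0 mul0r ltxx.
  have := opt; rewrite -[t - u - b]addrAC -[t - p - b]addrAC sqr_leB => opt'.
  set c := t - u - _.
  have : 0 <= (u - p) * c by rewrite /c; lra.
  move=> c0; rewrite -(pmulr_rge0 _ up0).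
  have -> : (u - p) * b * (b * c) = b ^+ 2 * ((u - p) * c) by ring.
  by rewrite mulr_ge0 ?sqr_ge0.
set h := b - _ in h0 hb *.
have h2 : 0 <= h * (t - u - h).
  have b0 : 0 < b ^+ 2.
    by rewrite exprn_even_gt0//=; apply/eqP => b0; move: h0; rewrite b0 mul0r ltxx.
  rewrite -(pmulr_rge0 _ b0).
  have -> : b ^+ 2 * (h * (t - u - h)) = b * h * (b * (t - u - h)) by ring.
  by rewrite pmulr_rge0.
have : h != 0 by apply/eqP => h00; move: h0; rewrite h00 mulr0 ltxx.
rewrite -sqrf_eq0 => hn0; have : 0 < h ^+ 2 by rewrite lt_def hn0 sqr_ge0.
rewrite expr2; nra.
Qed.

(** * Almost-everywhere arguments *)

(** This turns an equilibrium inequality into an almost sure one: a deviation that is almost surely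
    no worse can be strictly better only on a null set. Almost everywhere [f = g + k] with [k >= 0];
    the finite integral of [g] cancels and leaves [k] with integral 0. *)
Lemma ae_eq_of_le_integral d (T : measurableType d) (R : realType)
    (mu : {measure set T -> \bar R}) (f g : T -> R) :
  measurable_fun setT f -> measurable_fun setT g ->
  (forall x, 0 <= g x) -> {ae mu, forall x, g x <= f x} ->
  (\int[mu]_x (f x)%:E < +oo)%E ->
  (\int[mu]_x (f x)%:E <= \int[mu]_x (g x)%:E)%E ->
  {ae mu, forall x, f x = g x}.
Proof.
move=> mf mg g0 gf foo fg.
(* Truncating at 0 makes [k] nonnegative everywhere, although [g <= f] holds only almost
   everywhere. *)
pose k x := Num.max (f x - g x) 0.
have mk : measurable_fun setT k by apply: measurable_maxr => //; apply: measurable_funB.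
have k0 x : 0 <= k x by rewrite le_max lexx orbT.
have Ig0 : (0 <= \int[mu]_x (g x)%:E)%E by apply: integral_ge0 => x _; rewrite lee_fin.
have aefk : {ae mu, forall x, f x = g x + k x}.
  apply: filterS gf => x gf; rewrite /k max_l; first by rewrite addrC subrK.
  by rewrite subr_ge0.
pose f' x := g x + k x.
have Iff' : (\int[mu]_x (f x)%:E = \int[mu]_x (f' x)%:E)%E.
  apply: ae_eq_integral => //; try exact/measurable_EFinP.
  by apply/measurable_EFinP; apply: measurable_funD.
  by apply: filterS aefk => x -> _.
have Igoo : (\int[mu]_x (g x)%:E < +oo)%E.
  apply: le_lt_trans foo; rewrite Iff'; apply: ge0_le_integral => //.
  - by move=> x _; rewrite lee_fin.
  - exact/measurable_EFinP.
  - by apply/measurable_EFinP; apply: measurable_funD.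
  - by move=> x _; rewrite lee_fin lerDl.
have Ik0 : (\int[mu]_x `|(k x)%:E| = 0)%E.
  under eq_integral do rewrite gee0_abs ?lee_fin//.
  apply/eqP; rewrite eq_le; apply/andP; split; last first.
    by apply: integral_ge0 => x _; rewrite lee_fin.
  move: fg; rewrite Iff' /f'; under eq_integral do rewrite EFinD.
  rewrite ge0_integralD//=; last 4 first.
  - by move=> x _; rewrite lee_fin.
  - exact/measurable_EFinP.
  - by move=> x _; rewrite lee_fin.
  - exact/measurable_EFinP.
  by rewrite -[leRHS]adde0 leeD2lE// ge0_fin_numE.
have /(_ _)[|/(_ Ik0) k00 _] := ae_eq_integral_abs mu measurableT (f := EFin \o k).
  exact/measurable_EFinP.
apply: filterS2 aefk k00 => x -> /(_ I) [->]; exact: addr0.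
Qed.

Lemma ae_forall_countable d (T : sigmaRingType d) (R : realType)
    (mu : {measure set T -> \bar R}) (I : Type) (A : set I)
    (Q : I -> T -> Prop) :
  countable A -> (forall i, A i -> {ae mu, forall x, Q i x}) ->
  {ae mu, forall x, forall i, A i -> Q i x}.
Proof.
move=> /countable_injP[f finj] QA.
have /ae_foralln : forall n : nat, {ae mu, forall x, forall i, A i -> f i = n -> Q i x}.
  move=> n; have [[i [Ai fi]]|no] := pselect (exists i, A i /\ f i = n).
    apply: filterS (QA i Ai) => x Qx j Aj fj.
    by have -> : j = i by apply: finj; rewrite ?inE// fi.
  by apply: aeW => x i Ai fi; exfalso; apply: no; exists i.
by apply: filterS => x H i Ai; exact: (H (f i)).
Qed.

(** * Separated sets of reals *)

Definition separated (R : realType) (g : R) (A : set R) :=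
  forall p q, A p -> A q -> p < q -> g <= q - p.

(** Two points with the same [floor (p / g)] are less than [g] apart, so the floor is injective on
    [A]. *)
Lemma separated_countable (R : realType) (g : R) (A : set R) :
  0 < g -> separated R g A -> countable A.
Proof.
move=> g0 sA; apply/countable_injP.
exists (fun p => pickle (Num.floor (p / g))) => p q; rewrite !inE => Ap Aq.
move=> /(pcan_inj pickleK) pq.
wlog : p q Ap Aq pq / p < q.
  by move=> H; case: (ltgtP p q) => // lt; [|symmetry]; exact: H.
move=> lt_pq; have := sA _ _ Ap Aq lt_pq.
have /andP[p1 p2] := mem_rg1_floor (p / g); have /andP[q1 q2] := mem_rg1_floor (q / g).
move: p1 p2 q1 q2; rewrite -pq => p1 p2 q1 q2.
have : q / g - p / g < 1 by lra.
rewrite -mulrBl ltr_pdivrMr// mul1r; lra.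
Qed.

(** Take [p] within [g / 2] of the infimal distance. Without a nearest point there are [q] and [r],
    each strictly closer than the last. Two of the three lie on the same side of [t], so they differ
    by less than [g / 2], against separation. *)
Lemma separated_nearest (R : realType) (g : R) (A : set R) (t : R) :
  0 < g -> separated R g A -> A !=set0 ->
  exists2 p, A p & forall q, A q -> (t - p) ^+ 2 <= (t - q) ^+ 2.
Proof.
move=> g0 sA [a Aa].
pose D := [set `|t - p| | p in A].
have infD : has_inf D.
  by split; [exists `|t - a|, a | exists 0 => _ [p _ <-]].
have g2 : 0 < g / 2 by lra.
have dle p : A p -> inf D <= `|t - p|.
  by move=> Ap; apply: ge_inf; [exact: infD.2|exists p].
have [_ [p Ap <-] pd] := inf_adherent g2 infD.
apply: contrapT => no.
have closer p0 : A p0 -> exists2 q, A q & `|t - q| < `|t - p0|.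
  move=> Ap0; apply: contrapT => no'; apply: no; exists p0 => // q Aq.
  rewrite -[leLHS]real_normK ?num_real// -[leRHS]real_normK ?num_real//.
  by rewrite lerXn2r ?nnegrE// leNgt; apply/negP => h; apply: no'; exists q.
have [q Aq qp] := closer _ Ap; have [r Ar rq] := closer _ Aq.
have := dle _ Ap; have := dle _ Aq; have := dle _ Ar.
have sep x y : A x -> A y -> x <> y -> g <= y - x \/ g <= x - y.
  move=> Ax Ay; case: (ltgtP x y) => // xy _; first by left; apply: sA.
  by right; apply: sA.
have pq : p <> q by move=> pq; move: qp; rewrite pq ltxx.
have qr : q <> r by move=> qr; move: rq; rewrite qr ltxx.
have pr : p <> r by move=> pr; move: (lt_trans rq qp); rewrite pr ltxx.
have [|] := sep p q Ap Aq pq; have [|] := sep q r Aq Ar qr;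
  have [|] := sep p r Ap Ar pr; move: pd qp rq; case: (ger0P (t - p));
  case: (ger0P (t - q)); case: (ger0P (t - r)); lra.
Qed.

(** * Measurability, square integrability and monotone selections *)

Lemma mfun_of_measurable d1 d2 (T1 : measurableType d1) (T2 : measurableType d2)
    (f : T1 -> T2) :
  measurable_fun setT f -> exists F : {mfun T1 >-> T2}, F = f :> (T1 -> T2).
Proof.
move=> mf; pose F := HB.pack_for {mfun T1 >-> T2} f
  (@isMeasurableFun.Build _ _ _ _ f mf).
by exists F.
Qed.

(** Every preimage is countable or co-countable. This gives measurability of a map obtained by
    choice on a countable set. *)
Lemma measurable_fun_cocountable d1 d2 (T1 : measurableType d1)
    (T2 : measurableType d2) (f : T1 -> T2) (A : set T1) (y : T2) :
  (forall t : T1, measurable [set t]) -> countable A ->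
  (forall t, ~ A t -> f t = y) -> measurable_fun setT f.
Proof.
move=> m1 cA fA _ B mB; rewrite setTI.
rewrite -[f @^-1` B](setUIDK _ A).
have mAB E : measurable (A `&` E).
  apply: countable_measurable => //; apply: sub_countable cA.
  by apply: subset_card_le; apply: subIsetl.
rewrite setIC; apply: measurableU => //.
have [By|nBy] := pselect (B y).
  have -> : f @^-1` B `\` A = ~` A.
    by apply/seteqP; split => t; [case|move=> nA; split => //=; rewrite fA].
  by apply: measurableC; rewrite -(setIid A).
have -> : f @^-1` B `\` A = set0; last exact: measurable0.
by apply/seteqP; split => t //= [Bt nA]; apply: nBy; rewrite -(fA t).
Qed.

(** From [(x + c)^2 <= 2 x^2 + 2 c^2]. The two players' costs differ by the shift [b], so they are
    finite together. *)
Lemma integral_sqr_shift_lty d (T : measurableType d) (R : realType)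
    (P : probability T R) (f : T -> R) (c : R) :
  measurable_fun setT f -> (\int[P]_x (f x ^+ 2)%:E < +oo)%E ->
  (\int[P]_x ((f x + c) ^+ 2)%:E < +oo)%E.
Proof.
move=> mf foo.
have mf2 : measurable_fun setT (fun x => (f x ^+ 2)%:E).
  by apply/measurable_EFinP; apply: measurable_funX.
apply: (@le_lt_trans _ _ (\int[P]_x (2%:E * (f x ^+ 2)%:E + (2 * c ^+ 2)%:E))%E).
  apply: ge0_le_integral => //.
  - by move=> x _; rewrite lee_fin sqr_ge0.
  - by apply/measurable_EFinP; apply: measurable_funX; apply: measurable_funD.
  - by apply: emeasurable_funD => //; apply: measurable_funeM.
  - move=> x _; rewrite -EFinM -EFinD lee_fin.
    have := sqr_ge0 (f x - c); rewrite sqrrB sqrrD; lra.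
rewrite ge0_integralD//=; last 3 first.
- by move=> x _; rewrite -EFinM lee_fin mulr_ge0// sqr_ge0.
- exact: measurable_funeM.
- by move=> x _; rewrite lee_fin mulr_ge0// sqr_ge0.
rewrite ge0_integralZl_EFin//; last by move=> x _; rewrite lee_fin sqr_ge0.
rewrite integral_cst//; apply: lte_add_pinfty; apply: lte_mul_pinfty => //.
  by rewrite lee_fin mulr_ge0// sqr_ge0.
by rewrite (le_lt_trans (probability_le1 P _))// ltry.
Qed.

(** If [s < t] and [v t < v s], adding the two minimality inequalities gives
    [(v s - v t) * (t - s) <= 0], however ties are broken. *)
Lemma nearest_homo (R : realFieldType) (A : set R) (v : R -> R) :
  (forall t, A (v t)) ->
  (forall t q, A q -> (t - v t) ^+ 2 <= (t - q) ^+ 2) ->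
  {homo v : s t / s <= t}.
Proof.
move=> Av near s t; rewrite le_eqVlt => /predU1P[->//|st].
rewrite leNgt; apply/negP => vts.
have := near s _ (Av t); have := near t _ (Av s).
rewrite !sqr_leB => ht hs.
have : 0 < (v s - v t) * (t - s) by rewrite mulr_gt0// subr_gt0.
lra.
Qed.

(** * Actions lying in no gap *)

Section Gap.
Context {R : realType} {dX : measure_display} {X : measurableType dX}.
Variables (b : R) (gd : decoder_policy R X).

(* [0 < (y - p) * b < 2 b ^ 2] says that y lies strictly between p and p + 2b,
   whatever the sign of b. *)
Definition isolated_actions : set R :=
  range gd `&` [set y | forall x, ~~ (0 < (y - gd x) * b < b ^+ 2 *+ 2)].

(** For [b > 0] the larger point avoids the gap above the smaller one; for [b < 0] the smaller
    avoids the gap below the larger. *)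
Lemma isolated_actions_separated : separated R (`|b| *+ 2) isolated_actions.
Proof.
move=> p q [[x _ <-] np] [[y _ <-] nq] pq.
have := nq x; have := np y; rewrite !negb_and -!leNgt.
have [b0|b0|->] := ltgtP b 0; last by rewrite normr0; lra.
- move=> /orP[|h _]; first by rewrite leNgt nmulr_lgt0// subr_lt0 pq.
  by rewrite ltr0_norm// -(ler_nM2r b0); lra.
- move=> _ /orP[|h]; first by rewrite leNgt pmulr_lgt0// subr_gt0 pq.
  by rewrite gtr0_norm// -(ler_pM2r b0); lra.
Qed.

(** Gaps are open and there may be uncountably many; rational intervals inside them leave only
    countably many null sets to discard. *)
Lemma rat_interval_in_gap (x : X) (y : R) : 0 < (y - gd x) * b < b ^+ 2 *+ 2 ->
  exists r s : rat, ratr r < y < ratr s /\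
    forall z, ratr r < z < ratr s -> 0 < (z - gd x) * b < b ^+ 2 *+ 2.
Proof.
move=> /andP[].
have [b0|b0|->] := ltgtP b 0; last by rewrite mulr0 ltxx.
- rewrite nmulr_lgt0// => y1 y2.
  have {}y2 : gd x + b *+ 2 < y by rewrite -subr_gt0 -(nmulr_llt0 _ b0); lra.
  have [r] := rat_in_itvoo y2; rewrite in_itv/= => /andP[r1 r2].
  have {}y1 : y < gd x by rewrite -subr_lt0.
  have [s] := rat_in_itvoo y1; rewrite in_itv/= => /andP[s1 s2].
  exists r, s; rewrite r2 s1; split=> // z /andP[rz zs].
  rewrite nmulr_lgt0// subr_lt0 (lt_trans zs s2)/=.
  rewrite expr2 -mulrnAl ltr_nM2r//; lra.
- rewrite pmulr_lgt0// => y1 y2.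
  have {}y2 : y < gd x + b *+ 2 by rewrite -subr_gt0 -(pmulr_lgt0 _ b0); lra.
  have [s] := rat_in_itvoo y2; rewrite in_itv/= => /andP[s1 s2].
  have {}y1 : gd x < y by rewrite -subr_gt0.
  have [r] := rat_in_itvoo y1; rewrite in_itv/= => /andP[r1 r2].
  exists r, s; rewrite r2 s1; split=> // z /andP[rz zs].
  rewrite pmulr_lgt0// subr_gt0 (lt_trans r1 rz)/=.
  rewrite expr2 -mulrnAl ltr_pM2r//; lra.
Qed.
End Gap.

(** * Costs and equilibria of the game *)

Section Equilibrium.
Context {R : realType} {dO dX : measure_display}.
Context {Omega : measurableType dO} {X : measurableType dX}.
Context (P : probability Omega R) (m : {RV P >-> R}) (b : R).
Implicit Types (ge : encoder_policy R X) (gd : decoder_policy R X).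

Lemma measurable_action ge gd : measurable_fun setT (fun w => gd (ge (m w))).
Proof.
apply: (measurableT_comp (f := gd)) => //.
exact: (measurableT_comp (f := ge)).
Qed.

Lemma measurable_decoder_cost ge gd :
  measurable_fun setT (fun w => decoder_cost (m w) (gd (ge (m w)))).
Proof.
apply: measurable_funX; apply: measurable_funB => //.
exact: measurable_action.
Qed.

Lemma measurable_encoder_cost ge gd :
  measurable_fun setT (fun w => encoder_cost b (m w) (gd (ge (m w)))).
Proof.
apply: measurable_funX; apply: measurable_funB => //; apply: measurable_funB => //.
exact: measurable_action.
Qed.

Lemma Je_ae_eq ge gd ge' gd' :
  {ae P, forall w, gd (ge (m w)) = gd' (ge' (m w))} ->
  Je m b ge gd = Je m b ge' gd'.
Proof.
move=> E; rewrite /Je unlock; apply: ae_eq_integral => //.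
- by apply/measurable_EFinP; exact: measurable_encoder_cost.
- by apply/measurable_EFinP; exact: measurable_encoder_cost.
- by apply: filterS E => w -> _.
Qed.

Lemma Jd_ae_eq ge gd ge' gd' :
  {ae P, forall w, gd (ge (m w)) = gd' (ge' (m w))} ->
  Jd m ge gd = Jd m ge' gd'.
Proof.
move=> E; rewrite /Jd unlock; apply: ae_eq_integral => //.
- by apply/measurable_EFinP; exact: measurable_decoder_cost.
- by apply/measurable_EFinP; exact: measurable_decoder_cost.
- by apply: filterS E => w -> _.
Qed.

Lemma Je_lty_Jd_lty ge gd : (Je m b ge gd < +oo -> Jd m ge gd < +oo)%E.
Proof.
rewrite /Je /Jd unlock => /(integral_sqr_shift_lty _ _ _ _ _ b).
under eq_integral do rewrite subrK.
apply; apply: measurable_funB => //; apply: measurable_funB => //.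
exact: measurable_action.
Qed.

Lemma Jd_lty_Je_lty ge gd : (Jd m ge gd < +oo -> Je m b ge gd < +oo)%E.
Proof.
rewrite /Je /Jd unlock => /(integral_sqr_shift_lty _ _ _ _ _ (- b)).
apply; apply: measurable_funB => //; exact: measurable_action.
Qed.

Variables (ge : encoder_policy R X) (gd : decoder_policy R X).
Hypothesis nash : nash_equilibrium m b ge gd.

(** Any reply to a constant encoder acts as a constant decoder, which costs infinity against [ge]
    since [gd] is optimal there and [Jd] is infinite. Hence every cost against [qe] is infinite. *)
Lemma constant_encoder_nash (x : X) (qe : encoder_policy R X) :
  qe = cst x :> (R -> X) ->
  Je m b ge gd = +oo%E ->
  [/\ nash_equilibrium m b qe gd, Je m b qe gd = +oo%E & Jd m qe gd = +oo%E].
Proof.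
move=> qex Joo.
have oo (z : \bar R) : ~ (z < +oo)%E -> z = +oo%E.
  by move=> /negP; rewrite -leNgt leye_eq => /eqP.
have Jdoo : Jd m ge gd = +oo%E.
  by apply: oo => /Jd_lty_Je_lty; rewrite Joo.
have qoo gd' : Jd m qe gd' = +oo%E.
  have [F FE] := @mfun_of_measurable _ _ X R (cst (gd' x)) (measurable_cst _).
  have := nash.2 F; rewrite Jdoo leye_eq => /eqP <-.
  by apply: Jd_ae_eq; apply: aeW => w; rewrite FE qex.
have Jqoo gd' : Je m b qe gd' = +oo%E.
  by apply: oo => /Je_lty_Jd_lty; rewrite qoo.
split => //; split => [ge'|gd'].
  by rewrite Jqoo -Joo; exact: nash.1.
by rewrite !qoo.
Qed.

Hypothesis Jefin : (Je m b ge gd < +oo)%E.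

(** The deviation sends [x] exactly where that is strictly better. Its cost is the minimum of the
    two, so by optimality and finiteness it equals the original almost surely. *)
Lemma encoder_optimal_ae (x : X) :
  {ae P, forall w, (m w - gd (ge (m w)) - b) ^+ 2 <= (m w - gd x - b) ^+ 2}.
Proof.
pose f t := (t - gd (ge t) - b) ^+ 2; pose g t := (t - gd x - b) ^+ 2.
have mf : measurable_fun setT f.
  by apply: measurable_funX; do 2! apply: measurable_funB => //; apply: measurableT_comp.
have mg : measurable_fun setT g.
  by apply: measurable_funX; do 2! apply: measurable_funB => //.
have [ge' ge'E] : exists F : {mfun R >-> X},
    F = (fun t => if f t <= g t then ge t else x) :> (R -> X).
  apply: mfun_of_measurable; apply: measurable_fun_ifT => //.
  exact: measurable_fun_ler.
have := nash.1 ge'; have := Jefin; rewrite /Je unlock => foo fg.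
have := @ae_eq_of_le_integral _ _ _ P _ _
  (measurable_encoder_cost ge gd) (measurable_encoder_cost ge' gd).
have ge'f t : encoder_cost b t (gd (ge' t)) = Num.min (f t) (g t).
  by rewrite ge'E /encoder_cost; case: (leP (f t) (g t)).
have le_cost : {ae P, forall w,
    encoder_cost b (m w) (gd (ge' (m w))) <= encoder_cost b (m w) (gd (ge (m w)))}.
  by apply: aeW => w; rewrite ge'f ge_min lexx.
move=> /(_ (fun w => sqr_ge0 _) le_cost foo fg); apply: filterS => w.
by rewrite ge'f => /esym/min_idPl.
Qed.

(** The decoder deviates by the reply of [gap_gain] on the gap only. This gains strictly there
    almost surely, so at equilibrium the gap has probability zero. *)
Lemma no_action_in_gap_ae (x : X) :
  {ae P, forall w, ~~ (0 < (gd (ge (m w)) - gd x) * b < b ^+ 2 *+ 2)}.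
Proof.
pose A u := 0 < (u - gd x) * b < b ^+ 2 *+ 2.
have mA : measurable_fun setT A.
  by apply: measurable_and; apply: measurable_fun_ltr => //;
    apply: measurable_funM => //; apply: measurable_funB.
have [gd' gd'E] : exists F : {mfun X >-> R},
    F = (fun y => if A (gd y) then gd y + (b - (gd y - gd x) / 2) else gd y) :> (X -> R).
  apply: mfun_of_measurable; apply: measurable_fun_ifT => //.
    exact: measurableT_comp.
  apply: measurable_funD => //; apply: measurable_funB => //.
  by apply: measurable_funM => //; apply: measurable_funB.
have := nash.2 gd'; have := Je_lty_Jd_lty _ _ Jefin; rewrite /Jd unlock => foo fg.
have := @ae_eq_of_le_integral _ _ _ P _ _
  (measurable_decoder_cost ge gd) (measurable_decoder_cost ge gd').
have opt : {ae P, forall w, A (gd (ge (m w))) ->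
    decoder_cost (m w) (gd' (ge (m w))) < decoder_cost (m w) (gd (ge (m w)))}.
  apply: filterS (encoder_optimal_ae x) => w opt Aw.
  by rewrite gd'E Aw; exact: gap_gain.
have le_cost : {ae P, forall w,
    decoder_cost (m w) (gd' (ge (m w))) <= decoder_cost (m w) (gd (ge (m w)))}.
  apply: filterS opt => w.
  case: (boolP (A (gd (ge (m w))))) => [_ /(_ isT)/ltW//|nA _].
  by rewrite gd'E (negbTE nA).
move=> /(_ (fun w => sqr_ge0 _) le_cost foo fg).
apply: filterS2 opt => w opt eq; apply/negP => /opt; by rewrite eq ltxx.
Qed.

Lemma isolated_action_ae : {ae P, forall w, isolated_actions b gd (gd (ge (m w)))}.
Proof.
(* [G i] says that the rational interval [i] is contained in the gap of some action. *)
pose G (i : rat * rat) := exists x, forall z,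
  ratr i.1 < z < ratr i.2 -> 0 < (z - gd x) * b < b ^+ 2 *+ 2.
pose Q i w := G i -> ~~ (ratr i.1 < gd (ge (m w)) < ratr i.2).
have : {ae P, forall w i, [set: rat * rat] i -> Q i w}.
  apply: ae_forall_countable => // i _.
  have [[x Hx]|no] := pselect (G i); last by apply: aeW => w /no.
  have := no_action_in_gap_ae x.
  by apply: filterS => w nw _; apply: contra nw => /Hx.
apply: filterS => w Qw; split; first by exists (ge (m w)).
move=> x; apply/negP => /rat_interval_in_gap[r [s [rs H]]].
by have := Qw (r, s) I (ex_intro _ x H); rewrite rs.
Qed.

(** Encoder optimality has one exceptional null set per action; countability of the isolated actions
    makes it uniform. *)
Lemma nearest_action_ae (b0 : b != 0) :
  {ae P, forall w p, isolated_actions b gd p ->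
     (m w - b - gd (ge (m w))) ^+ 2 <= (m w - b - p) ^+ 2}.
Proof.
apply: ae_forall_countable.
  apply: separated_countable (isolated_actions_separated b gd).
  by rewrite pmulrn_lgt0 ?normr_gt0.
move=> _ [[x _ <-] _]; apply: filterS (encoder_optimal_ae x) => w.
by rewrite addrAC [m w - _ - b]addrAC.
Qed.

(** The new encoder sends [c (v (t - b))]: [v] selects a nearest isolated action, and [c] a message
    inducing it. *)
Lemma quantized_equilibrium_of_finite_cost (b0 : b != 0) : exists qe : encoder_policy R X,
    [/\ quantized qe, convex_bins qe, nash_equilibrium m b qe gd,
        Je m b qe gd = Je m b ge gd & Jd m qe gd = Jd m ge gd].
Proof.
set A := isolated_actions b gd.
have g0 : 0 < `|b| *+ 2 by rewrite pmulrn_lgt0 ?normr_gt0.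
have sepA : separated R (`|b| *+ 2) A := isolated_actions_separated b gd.
have cA := separated_countable _ _ _ g0 sepA.
(* An almost sure property under a probability holds at some point. *)
have A0 : A !=set0.
  have : (\forall w \ae P, exists p, A p).
    by apply: filterS isolated_action_ae => w Aw; eexists; exact: Aw.
  move=> /(@filter_ex _ _ _)[|w //].
  have PT : P setT = 1%E := probability_setT P.
  by apply: ae_properfilter_algebraOfSetsType; rewrite [ltRHS]PT.
pose near t p := A p /\ forall q, A q -> (t - p) ^+ 2 <= (t - q) ^+ 2.
(* Ties between nearest points must be broken as the given equilibrium does:
   otherwise Jd could change. *)
have [v vP] : {v : R -> R & forall t, near t (v t) /\
    (near t (gd (ge (t + b))) -> v t = gd (ge (t + b)))}.
  apply: (@choice _ _ (fun t p => near t p /\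
    (near t (gd (ge (t + b))) -> p = gd (ge (t + b))))).
  move=> t; have [nt|nt] := pselect (near t (gd (ge (t + b)))).
    by exists (gd (ge (t + b))).
  have [p Ap pt] := separated_nearest _ _ _ t g0 sepA A0.
  by exists p.
have vA t : A (v t) by have [[]] := vP t.
have v_homo : {homo v : s t / s <= t}.
  by apply: nearest_homo vA _ => t q Aq; have [[_ +] _] := vP t; exact.
(* [c] is a right inverse of [gd] on [A]. Off [A] it takes the fixed message [ge 0], so that it is
   constant off a countable set. *)
have [c [cA' cN]] : exists c : R -> X,
    (forall y, A y -> gd (c y) = y) /\ (forall y, ~ A y -> c y = ge 0).
  have [c cP] : {c : R -> X & forall y, (A y -> gd (c y) = y) /\ (~ A y -> c y = ge 0)}.
    apply: (@choice _ _ (fun y x => (A y -> gd x = y) /\ (~ A y -> x = ge 0))) => y.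
    have [|nA] := pselect (A y); last by exists (ge 0).
    by move=> Ay; have [[x _ xy] _] := Ay; exists x.
  by exists c; split=> y; have [] := cP y.
have mc : measurable_fun setT c.
  exact: measurable_fun_cocountable cA cN.
have mv : measurable_fun setT v by apply: nondecreasing_measurable.
have [qe qeE] : exists F : {mfun R >-> X}, F = (fun t => c (v (t - b))) :> (R -> X).
  apply: mfun_of_measurable; apply: measurableT_comp => //; apply: measurableT_comp => //.
  exact: measurable_funB.
have gdqe t : gd (qe t) = v (t - b) by rewrite qeE cA'.
have vu : {ae P, forall w, v (m w - b) = gd (ge (m w))}.
  apply: filterS2 isolated_action_ae (nearest_action_ae b0) => w Aw nw.
  by have [_] := vP (m w - b); rewrite subrK; apply.
have qege : {ae P, forall w, gd (qe (m w)) = gd (ge (m w))}.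
  by apply: filterS vu => w; rewrite gdqe.
have JeE := Je_ae_eq _ _ _ _ qege; have JdE := Jd_ae_eq _ _ _ _ qege.
exists qe; split => //; last (split => [ge'|gd']; first by rewrite JeE; exact: nash.1).
- apply: (@sub_countable _ _ _ (c @` A)).
    by apply: subset_card_le => _ [t _ <-]; rewrite qeE; exists (v (t - b)).
  exact: sub_countable (card_image_le _ _) cA.
(* Equal messages induce equal actions, and monotonicity of [v] forces the same action, hence the
   same message, in between. *)
- move=> x s t /= sx tx r /andP[sr rt].
  have vst : v (s - b) = v (t - b) by rewrite -!gdqe sx tx.
  have vsr : v (r - b) = v (s - b).
    apply/eqP; rewrite eq_le {1}vst !v_homo// lerD2r//.
  by rewrite /bin /preimage /= -sx qeE vsr.
- (* Against qe, the reply gd' performs as gd' \o c \o gd does against ge. *)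
  have [F FE] : exists F : {mfun X >-> R}, F = (fun x => gd' (c (gd x))) :> (X -> R).
    by apply: mfun_of_measurable; apply: measurableT_comp => //; apply: measurableT_comp.
  rewrite JdE; suff -> : Jd m qe gd' = Jd m ge F by exact: nash.2.
  by apply: Jd_ae_eq; apply: filterS vu => w; rewrite FE qeE => ->.
Qed.
End Equilibrium.

Theorem mainTheorem1 (R : realType) (dO dX : measure_display)
    (Omega : measurableType dO) (X : measurableType dX)
    (P : probability Omega R) (m : {RV P >-> R}) (b : R) (b_neq0 : b <> 0)
    (ge : encoder_policy R X) (gd : decoder_policy R X) :
  nash_equilibrium m b ge gd ->
  exists qe : encoder_policy R X,
    [/\ quantized qe, convex_bins qe, nash_equilibrium m b qe gd,
        Je m b qe gd = Je m b ge gd & Jd m qe gd = Jd m ge gd].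
Proof.
move=> nash; have [fin|inf] := ltP (Je m b ge gd) +oo%E.
  by apply: quantized_equilibrium_of_finite_cost => //; apply/eqP.
have {}inf : Je m b ge gd = +oo%E by apply/eqP; rewrite -leye_eq.
(* [ge 0] is just some message; the single nonempty bin is the whole line. *)
have [qe qeE] := @mfun_of_measurable _ _ R X (cst (ge 0)) (measurable_cst _).
have [nq Jq Jdq] := constant_encoder_nash P m b ge gd nash _ _ qeE inf.
have Jdoo : Jd m ge gd = +oo%E.
  apply/eqP; rewrite -leye_eq leNgt; apply/negP => /(Jd_lty_Je_lty P m b).
  by rewrite inf.
exists qe; split; rewrite ?Jq ?Jdq ?inf ?Jdoo//.
- apply: (@sub_countable _ _ _ [set ge 0]) => //.
  by apply: subset_card_le => _ [t _ <-]; rewrite qeE.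
- by move=> x s t sx _ r _; move: sx; rewrite /bin /= !qeE.
Qed.
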